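(* Let $I\subseteq\mathbb{R}$ be an interval of positive length and let $f,g\colon I\to\mathbb{R}$ be strictly increasing functions (not assumed continuous). Assume that there exists $n\in\mathbb{N}\setminus\{1\}$ such that $\mathscr{A}_f^{[n]}(x)=\mathscr{A}_g^{[n]}(x)$ for all $x\in I^n$ and the set $\operatorname{int}\mathcal{I}(\mathscr{A}_f^{[n]})$ is $(2,\mathscr{A}_f^{[n]})$-attracting. Then there exists $\alpha\in\mathbb{R}$ such that $f-\alpha g$ is constant on every connected component of $\operatorname{int}\mathcal{I}(\mathscr{A}_f^{[n]})$ (with the same $\alpha$ for all components; the constant may depend on the component).
   Context: Here $\mathbb{N}=\{1,2,\dots\}$, $\operatorname{int}$ denotes the topological interior, and $\operatorname{conv}(S)$ is the smallest interval containing $S\subseteq\mathbb{R}$. Generalized inverse: for a strictly increasing $f\colon I\to\mathbb{R}$ (not necessarily continuous) there is a unique nondecreasing function $f^{(-1)}\colon\operatorname{conv}(f(I))\to I$ with $f^{(-1)}(f(x))=x$ for all $x\in I$; it is called the generalized inverse of $f$. Generalized quasiarithmetic mean: for $n\in\mathbb{N}$ and $x=(x_1,\dots,x_n)\in I^n$, $\mathscr{A}_f^{[n]}(x)=f^{(-1)}\Big(\frac{f(x_1)+\dots+f(x_n)}{n}\Big)$. It is a symmetric $n$-variable mean on $I$, i.e. a symmetric function $M\colon I^n\to I$ with $\min(x)\le M(x)\le\max(x)$ for all $x\in I^n$. For a symmetric mean $M\colon I^n\to I$: (1) A point $x\in I$ is an internality point of $M$ if for all $y_1,\dots,y_{n-1}\in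 I$, $M(x,y_1,\dots,y_{n-1})=x$ implies either $y_1=\dots=y_{n-1}=x$ or $\min(y_1,\dots,y_{n-1})<x<\max(y_1,\dots,y_{n-1})$. The set of all internality points of $M$ is denoted $\mathcal{I}(M)$. (2) A set $V\subset I$ is $(k,M)$-attracting if for all $x_1,\dots,x_k\in V$ there exist $x_{k+1},\dots,x_n\in I$ such that $M(x_1,\dots,x_n)\in V$. *)

(* Defs.v *)
From HB Require Import structures.
From mathcomp Require Import all_boot all_order all_algebra.
From mathcomp Require Import all_classical all_reals all_analysis.
Set Implicit Arguments.
Unset Strict Implicit.
Unset Printing Implicit Defensive.
Import Order.TTheory GRing.Theory Num.Theory.
Import numFieldNormedType.Exports.
Local Open Scope classical_set_scope.
Local Open Scope ring_scope.

(* Functions on the interval I are total functions R -> R of which only the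
   values on I matter; points of I^n are n-tuples whose entries lie in I. *)

Definition conv (R : realType) (S : set R) : set R := smallest (@is_interval R) S.

Definition strictly_increasing_on (R : realType) (I : set R) (f : R -> R) : Prop :=
  {in I &, {homo f : x y / x < y}}.

Definition is_generalized_inverse (R : realType) (I : set R) (f h : R -> R) : Prop :=
  [/\ forall y, conv (f @` I) y -> I (h y),
      {in conv (f @` I) &, {homo h : x y / x <= y}} &
      forall x, I x -> h (f x) = x].

(* A choice of h, which exists and is determined on conv (f @` I) when I is an
   interval and f is strictly increasing on I: see generalized_inverseP and
   generalized_inverse_unique. *)
Definition generalized_inverse (R : realType) (I : set R) (f : R -> R) : R -> R :=
  xget (fun=> 0) [set h | is_generalized_inverse I f h].

Definition quasiarithmetic_mean (R : realType) (I : set R) (f : R -> R) (n : nat)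
    (x : n.-tuple R) : R :=
  generalized_inverse I f ((\sum_(a <- x) f a) / n%:R).

(* The head is only a neutral starting value; the value on [::] is junk. *)
Definition seq_min (R : realType) (s : seq R) : R :=
  \big[Num.min/head 0 s]_(a <- s) a.
Definition seq_max (R : realType) (s : seq R) : R :=
  \big[Num.max/head 0 s]_(a <- s) a.

(* z is the n-tuple (x, y_1, ..., y_(n-1)). *)
Definition internality_point (R : realType) (I : set R) (n : nat)
    (M : n.-tuple R -> R) (x : R) : Prop :=
  I x /\
  forall (y : seq R) (z : n.-tuple R),
    z = x :: y :> seq R -> [set` y] `<=` I -> M z = x ->
    (forall a, a \in y -> a = x) \/ (seq_min y < x /\ x < seq_max y).

Definition internality_set (R : realType) (I : set R) (n : nat)
    (M : n.-tuple R -> R) : set R :=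
  [set x | internality_point I M x].

Definition attracting (R : realType) (I : set R) (n k : nat)
    (M : n.-tuple R -> R) (V : set R) : Prop :=
  V `<=` I /\
  forall x : k.-tuple R, [set` x] `<=` V ->
    exists (y : seq R) (z : n.-tuple R),
      [/\ z = x ++ y :> seq R, [set` y] `<=` I & V (M z)].

Lemma convE (R : realType) (S : set R) :
  conv S = [set y | exists a b, [/\ S a, S b & a <= y <= b]].
Proof.
apply/seteqP; split=> [y|y [a [b [Sa Sb aybP]]] A [Ai SA]]; last first.
  by apply: (Ai a b _ _ y aybP); apply: SA.
apply; split=> [u v [a [b [Sa Sb /andP[au _]]]] [c [d [Sc Sd /andP[_ vd]]]] z|u Su].
  move=> /andP[uz zv]; exists a, d; split=> //.
  by rewrite (le_trans au uz) (le_trans zv vd).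
by exists u, u; rewrite lexx.
Qed.

Lemma generalized_inverse_unique (R : realType) (I : set R) (f h1 h2 : R -> R) :
  is_interval I -> strictly_increasing_on I f ->
  is_generalized_inverse I f h1 -> is_generalized_inverse I f h2 ->
  {in conv (f @` I), h1 =1 h2}.
Proof.
move=> itvI fincr.
suff wl k1 k2 y : is_generalized_inverse I f k1 -> is_generalized_inverse I f k2 ->
    y \in conv (f @` I) -> k1 y <= k2 y.
  by move=> h1P h2P y yC; apply/eqP; rewrite eq_le !wl.
move=> [I1 mono1 can1] [I2 mono2 can2] yC.
rewrite leNgt; apply/negP => lt21.
have k1I := I1 y (set_mem yC); have k2I := I2 y (set_mem yC).
pose m := (k2 y + k1 y) / 2.
have lt2m : k2 y < m by rewrite midf_lt.
have ltm1 : m < k1 y by rewrite midf_lt.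
have mI : I m by apply: (itvI _ _ k2I k1I); rewrite !ltW.
have fmC : f m \in conv (f @` I).
  by rewrite convE inE; exists (f m), (f m); rewrite lexx; split=> //; exists m.
have [yfm|fmy] := leP y (f m).
  by have := mono1 _ _ yC fmC yfm; rewrite can1// leNgt ltm1.
by have := mono2 _ _ fmC yC (ltW fmy); rewrite can2// leNgt lt2m.
Qed.

Lemma generalized_inverseP (R : realType) (I : set R) (f : R -> R) :
  is_interval I -> strictly_increasing_on I f ->
  is_generalized_inverse I f (generalized_inverse I f).
Proof.
move=> itvI fincr.
have fleP a x : I a -> I x -> f a <= f x -> a <= x.
  move=> Ia Ix; rewrite leNgt => afx; rewrite leNgt; apply/negP => xa.
  by move: afx; rewrite fincr// inE.
pose L y := [set x | I x /\ f x <= y].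
pose h y := sup (L y).
have Lsup y : conv (f @` I) y -> has_sup (L y).
  rewrite convE => -[_ [_ [[a Ia <-] [b Ib <-] /andP[ay yb]]]].
  split; first by exists a.
  by exists b => x [Ix xy]; apply: fleP => //; apply: le_trans yb.
apply: (@xgetPex _ (fun=> 0) [set k | is_generalized_inverse I f k]).
exists h; split=> [y yC|x y xC yC xy|x Ix].
- have Ly := Lsup y yC; move: yC.
  rewrite convE => -[_ [_ [[a Ia <-] [b Ib <-] /andP[ay yb]]]].
  apply: (itvI _ _ Ia Ib); apply/andP; split.
    by apply: ub_le_sup; [case: Ly|].
  apply: ge_sup; first by case: Ly.
  by move=> x [Ix xy]; apply: fleP => //; apply: le_trans yb.
- move/set_mem: xC => xC; move/set_mem: yC => yC.
  have [_ uby] := Lsup y yC; have [nex _] := Lsup x xC.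
  apply: ge_sup => // t [It tx]; apply: ub_le_sup => //.
  by split=> //; apply: le_trans xy.
- have fxC : conv (f @` I) (f x).
    by rewrite convE; exists (f x), (f x); rewrite lexx; split=> //; exists x.
  have [ne ub] := Lsup _ fxC.
  apply/eqP; rewrite eq_le; apply/andP; split.
    by apply: ge_sup => // t [It tx]; apply: fleP.
  by apply: ub_le_sup => //; split.
Qed.

(* Main.v *)
(** At an interior internality point f and g are continuous, so for such m the
    equation M(x_1, ..., x_n) = m means that the f(x_i) average to f(m), and
    equivalently that the g(x_i) average to g(m). On a segment [a, b] of such
    points, f minus the affine function of g that agrees with it at a and b
    satisfies a Jensen equation and vanishes at the endpoints, hence vanishes:
    an extremal value at c could be transported to a or b. The attracting
    property joins points p, q of two components to a mean m in the set;
    perturbing p or q alone moves m and shows that the increment ratio of f to g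
    near p, and near q, equals the one near m. *)

Require Import Defs.
From mathcomp Require Import all_boot all_order all_algebra.
From mathcomp Require Import all_classical all_reals all_analysis.
From mathcomp Require Import ring lra.
Import Order.TTheory GRing.Theory Num.Theory.
Import numFieldNormedType.Exports.
Local Open Scope classical_set_scope.
Local Open Scope ring_scope.

(** * Neighbourhoods, contraction and monotone continuity on the real line *)

Lemma nbhs_segment (R : realType) (p : R) (A : set R) : nbhs p A ->
  exists2 d, 0 < d & forall x, p - d <= x <= p + d -> A x.
Proof.
move=> /nbhs_ballP[e /= e0 eA]; exists (e / 2); first by lra.
by move=> x px; apply: eA; rewrite /ball /= ltr_distlC; lra.
Qed.

(** If [e] were a lower bound, [inf S] would be positive. An element [s] below [(2 - c) * inf S]
    would then be followed by some [t] below [inf S]: for positive [c] because [c * (2 - c) < 1],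
    otherwise because [c * s <= 0]. *)
Lemma contraction_arbitrarily_small (R : realType) (S : set R) (c : R) :
  c < 1 -> S !=set0 -> (forall s, S s -> 0 <= s) ->
  (forall s, S s -> exists2 t, S t & t <= c * s) ->
  forall e, 0 < e -> exists2 s, S s & s < e.
Proof.
move=> c1 S0 Sge0 Sc e e0; apply: contrapT => Se.
have lbe : lbound S e.
  by move=> s Ss; rewrite leNgt; apply/negP => se; apply: Se; exists s.
have ei : e <= inf S by apply: lb_le_inf.
have hlb : has_lbound S by exists e.
have i0 : 0 < (1 - c) * inf S by apply: mulr_gt0; lra.
have [s Ss si] := inf_adherent i0 (conj S0 hlb).
have [t St ts] := Sc s Ss.
have it : inf S <= t by apply: ge_inf.
have s0 := Sge0 s Ss.
have [c0|c0] := leP c 0; nra.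
Qed.

(** By monotonicity, a single point with small increment on each side of [p] controls all the points
    in between. *)
Lemma increasing_continuous_at (R : realType) (I : set R) (f : R -> R) (p : R) :
  is_interval I -> strictly_increasing_on I f -> I p ->
  (forall e, 0 < e -> exists2 t, I t /\ p < t & f t - f p < e) ->
  (forall e, 0 < e -> exists2 t, I t /\ t < p & f p - f t < e) ->
  {for p, continuous f}.
Proof.
move=> hI hf Ip hr hl; apply/cvgrPdist_lt => e e0.
have [t [It pt] fte] := hr e e0; have [s [Is sp] fse] := hl e e0.
have : \forall x \near p, x \in `]s, t[.
  by apply: near_in_itvoo; rewrite in_itv /= sp pt.
apply: filterS => x; rewrite in_itv /= => /andP[sx xt].
have Ix : I x by apply: (hI _ _ Is It); rewrite !ltW.
have fsx : f s < f x by rewrite hf ?inE.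
have fxt : f x < f t by rewrite hf ?inE.
have fsp : f s < f p by rewrite hf ?inE.
rewrite ltr_distlC; apply/andP; split; last by lra.
by lra.
Qed.

(** * Extrema, sums and averages over finite sequences *)

Lemma seq_min_nseq (R : realType) (k : nat) (x : R) : seq_min (nseq k.+1 x) = x.
Proof.
by rewrite /seq_min big_nseq /=; elim: k => [|k IH] /=; rewrite ?minxx // IH minxx.
Qed.

Lemma seq_max_nseq (R : realType) (k : nat) (x : R) : seq_max (nseq k.+1 x) = x.
Proof.
by rewrite /seq_max big_nseq /=; elim: k => [|k IH] /=; rewrite ?maxxx // IH maxxx.
Qed.

Lemma seq_argmin (R : realType) (T : eqType) (f : T -> R) (s : seq T) :
  (0 < size s)%N -> exists2 a, a \in s & forall x, x \in s -> f a <= f x.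
Proof.
case: s => // a s _; elim: s a => [|b s IH] a.
  by exists a; rewrite ?mem_seq1 // => x; rewrite mem_seq1 => /eqP->.
have [c cs hc] := IH b.
have [ac|ca] := leP (f a) (f c).
  exists a; first by rewrite mem_head.
  move=> x; rewrite in_cons => /predU1P[->//|xs].
  by rewrite (le_trans ac) // hc.
exists c; first by rewrite in_cons cs orbT.
move=> x; rewrite in_cons => /predU1P[->|xs]; first exact: ltW.
exact: hc.
Qed.

Lemma sum_ge_size_mul (R : realType) (f : R -> R) (s : seq R) (c : R) :
  (forall x, x \in s -> c <= f x) -> (size s)%:R * c <= \sum_(x <- s) f x.
Proof.
elim: s => [|a s IH] h; first by rewrite big_nil mul0r.
rewrite big_cons /= -natr1 mulrDl mul1r addrC lerD //.
  by rewrite h // mem_head.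
by apply: IH => x xs; rewrite h // in_cons xs orbT.
Qed.

(** Needed to keep the argument of the generalized inverse in the set where that inverse is
    determined. *)
Lemma average_conv (R : realType) (I : set R) (f : R -> R) (s : seq R) :
  (0 < size s)%N -> [set` s] `<=` I ->
  Defs.conv (f @` I) ((\sum_(x <- s) f x) / (size s)%:R).
Proof.
move=> s0 sI; rewrite Defs.convE.
have [a as_ fa] := seq_argmin _ _ f _ s0.
(* The greatest value of [f] is obtained by minimising [- f]. *)
have [b bs fb] := seq_argmin _ _ (fun x => - f x) _ s0.
have n0 : 0 < (size s)%:R :> R by rewrite ltr0n.
exists (f a), (f b); split.
- by exists a => //; apply: sI.
- by exists b => //; apply: sI.
rewrite ler_pdivlMr // ler_pdivrMr // mulrC sum_ge_size_mul //=.
have := sum_ge_size_mul _ _ _ _ fb.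
by rewrite sumrN mulrN lerN2 mulrC.
Qed.

(** * Generalized inverse, and continuity at internality points *)

Lemma le_generalized_inverse (R : realType) (I : set R) (f : R -> R) (x u : R) :
  is_interval I -> strictly_increasing_on I f -> I x -> Defs.conv (f @` I) u ->
  f x <= u -> x <= generalized_inverse I f u.
Proof.
move=> hI hf Ix Cu fxu.
have [_ mono can] := generalized_inverseP hI hf.
rewrite -(can x Ix); apply: mono; rewrite ?inE //.
by rewrite Defs.convE; exists (f x), (f x); rewrite lexx; split=> //; exists x.
Qed.

Lemma ge_generalized_inverse (R : realType) (I : set R) (f : R -> R) (x u : R) :
  is_interval I -> strictly_increasing_on I f -> I x -> Defs.conv (f @` I) u ->
  u <= f x -> generalized_inverse I f u <= x.
Proof.
move=> hI hf Ix Cu fxu.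
have [_ mono can] := generalized_inverseP hI hf.
rewrite -(can x Ix); apply: mono; rewrite ?inE //.
by rewrite Defs.convE; exists (f x), (f x); rewrite lexx; split=> //; exists x.
Qed.

(** The entries after [p] all equal [x], so their minimum and maximum coincide and cannot lie
    strictly on both sides of [p]. *)
Lemma mean_ne_internality_point (R : realType) (I : set R) (n : nat)
    (M : n.-tuple R -> R) (p x : R) (z : n.-tuple R) :
  (1 < n)%N -> internality_point I M p -> I x -> x <> p ->
  z = p :: nseq n.-1 x :> seq R -> M z <> p.
Proof.
case: n M z => [//|[//|k]] M z _ [Ip hp] Ix xp zE Mz.
have xI : [set` nseq k.+1 x] `<=` I by move=> a /(@nseqP _ k.+1)[->].
have [h|[]] := hp _ z zE xI Mz.
  by apply: xp; apply: h; rewrite mem_head.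
by rewrite seq_min_nseq seq_max_nseq => /lt_trans h /h; rewrite ltxx.
Qed.

(** Written as a displacement from [f p], so that the contraction factor [1 - n%:R^-1] of the
    continuity argument is visible. *)
Lemma sum_cons_nseq (R : realType) (f : R -> R) (n : nat) (p x : R) : (0 < n)%N ->
  (\sum_(a <- p :: nseq n.-1 x) f a) / n%:R = f p + (1 - n%:R^-1) * (f x - f p).
Proof.
case: n => // n _; rewrite big_cons big_nseq iter_addr_0 -mulr_natr -natr1.
have n1 : n%:R + 1 != 0 :> R by rewrite natr1 pnatr_eq0.
by rewrite /=; field.
Qed.

Lemma sum_cons2_nseq (R : realType) (f : R -> R) (n : nat) (x y z : R) :
  (1 < n)%N ->
  \sum_(a <- x :: y :: nseq n.-2 z) f a = f x + f y + (n%:R - 2) * f z.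
Proof.
move=> hn; rewrite !big_cons big_nseq iter_addr_0 addrA -[f z *+ _]mulr_natl.
by rewrite -[n.-2]subn2 natrB.
Qed.

Lemma mean_cons_nseq (R : realType) (I : set R) (f : R -> R) (n : nat) (p x : R) :
  is_interval I -> strictly_increasing_on I f -> (1 < n)%N ->
  internality_point I (@quasiarithmetic_mean R I f n) p -> I x -> x <> p ->
  let u := f p + (1 - n%:R^-1) * (f x - f p) in
  Defs.conv (f @` I) u /\ generalized_inverse I f u <> p.
Proof.
move=> hI hf hn hp Ix xp u.
have zP : size (p :: nseq n.-1 x) = n by rewrite /= size_nseq prednK // ltnW.
have zI : [set` p :: nseq n.-1 x] `<=` I.
  move=> a /predU1P[->|/nseqP[->]] //; exact: hp.1.
have uE : (\sum_(a <- p :: nseq n.-1 x) f a) / n%:R = u.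
  by apply: sum_cons_nseq; rewrite ltnW.
split.
  by rewrite -uE -{2}zP; apply: average_conv.
have := @mean_ne_internality_point R I n _ p x (Tuple (introT eqP zP)) hn hp Ix xp erefl.
by rewrite /quasiarithmetic_mean /= uE.
Qed.

(* Were the jump of f at p positive, a tuple (p, x, ..., x) with x close to p
   would have its average inside the jump and hence mean p; quantitatively, the
   oscillation on either side of p can always be shrunk by the factor 1 - 1/n. *)
Lemma internality_point_continuous (R : realType) (I : set R) (f : R -> R)
    (n : nat) (p : R) :
  is_interval I -> strictly_increasing_on I f -> (1 < n)%N -> nbhs p I ->
  internality_point I (@quasiarithmetic_mean R I f n) p -> {for p, continuous f}.
Proof.
move=> hI hf hn pI hp; have Ip := hp.1.
have [d d0 dI] := nbhs_segment _ _ _ pI.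
have n1 : 0 < (n%:R : R)^-1 < 1.
  by rewrite invr_gt0 ltr0n (ltnW hn) invf_lt1 ?ltr0n ?ltr1n ?hn // ltnW.
apply: (increasing_continuous_at _ I) => // e e0.
- pose S := [set f x - f p | x in [set x | I x /\ p < x]].
  have [||||_ [x xS <-] ?] := @contraction_arbitrarily_small R S (1 - n%:R^-1) _ _ _ _ e e0; last by exists x.
  + by lra.
  + exists (f (p + d) - f p), (p + d) => //; split; last by lra.
    by apply: dI; lra.
  + by move=> _ [x [Ix px] <-]; rewrite subr_ge0 ltW // hf ?inE.
  move=> _ [x [Ix px] <-].
  have xp : x <> p by move=> xp; rewrite xp ltxx in px.
  have [Cu] := mean_cons_nseq _ _ _ _ _ _ hI hf hn hp Ix xp.
  have fpx : f p < f x by rewrite hf ?inE.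
  set u := _ + _; set m := generalized_inverse I f u => mp.
  (* Monotonicity gives [p <= m], and internality excludes equality. *)
  have pm : p < m.
    rewrite lt_neqAle eq_sym; apply/andP; split; first exact/eqP.
    apply: le_generalized_inverse => //.
    by rewrite lerDl mulr_ge0 //; lra.
  have mx : m <= x.
    apply: ge_generalized_inverse => //; rewrite /u; nra.
  (* A point of [I] below [m] has value at most [u], since a larger value would put [m] at or below
     that point. The midpoint therefore provides the contracted increment. *)
  have It : I ((p + m) / 2) by apply: (hI _ _ Ip Ix); lra.
  exists (f ((p + m) / 2) - f p).
    by exists ((p + m) / 2) => //; split => //; lra.
  suff : f ((p + m) / 2) <= u by rewrite /u; lra.
  rewrite leNgt; apply/negP => /ltW ut.
  have : m <= (p + m) / 2 by apply: ge_generalized_inverse.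
  by lra.
- pose S := [set f p - f x | x in [set x | I x /\ x < p]].
  have [||||_ [x xS <-] ?] := @contraction_arbitrarily_small R S (1 - n%:R^-1) _ _ _ _ e e0; last by exists x.
  + by lra.
  + exists (f p - f (p - d)), (p - d) => //; split; last by lra.
    by apply: dI; lra.
  + by move=> _ [x [Ix px] <-]; rewrite subr_ge0 ltW // hf ?inE.
  move=> _ [x [Ix px] <-].
  have xp : x <> p by move=> xp; rewrite xp ltxx in px.
  have [Cu] := mean_cons_nseq _ _ _ _ _ _ hI hf hn hp Ix xp.
  have fpx : f x < f p by rewrite hf ?inE.
  set u := _ + _; set m := generalized_inverse I f u => mp.
  have pm : m < p.
    rewrite lt_neqAle; apply/andP; split; first exact/eqP.
    apply: ge_generalized_inverse => //; rewrite /u; nra.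
  have mx : x <= m.
    apply: le_generalized_inverse => //; rewrite /u; nra.
  have It : I ((p + m) / 2) by apply: (hI _ _ Ix Ip); lra.
  exists (f p - f ((p + m) / 2)).
    by exists ((p + m) / 2) => //; split => //; lra.
  suff : u <= f ((p + m) / 2) by rewrite /u; lra.
  rewrite leNgt; apply/negP => /ltW ut.
  have : (p + m) / 2 <= m by apply: le_generalized_inverse.
  by lra.
Qed.

(** * From equations between means to equations between sums *)

(** If [f m < u], continuity keeps [f] below [u] at some [m + d] with [d > 0], so the inverse of [u]
    is at least [m + d]; the other case is symmetric. *)
Lemma generalized_inverseK_continuous (R : realType) (I : set R) (f : R -> R)
    (u m : R) :
  is_interval I -> strictly_increasing_on I f -> nbhs m I ->
  {for m, continuous f} -> Defs.conv (f @` I) u -> generalized_inverse I f u = m ->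
  u = f m.
Proof.
move=> hI hf mI fc Cu um.
apply/eqP; rewrite eq_le !leNgt; apply/andP; split; apply/negP => lt.
- have fu := cvgr_lt _ fc u lt.
  have [d d0 h] := nbhs_segment _ _ _ (filterI mI (fu _)).
  have [|Ix fx] := h (m + d); first by lra.
  have := le_generalized_inverse _ _ _ _ _ hI hf Ix Cu (ltW fx); rewrite um; lra.
- have fu := cvgr_gt _ fc u lt.
  have [d d0 h] := nbhs_segment _ _ _ (filterI mI (fu _)).
  have [|Ix fx] := h (m - d); first by lra.
  have := ge_generalized_inverse _ _ _ _ _ hI hf Ix Cu (ltW fx); rewrite um; lra.
Qed.

Lemma eq_mean_internality_point (R : realType) (I : set R) (n : nat)
    (M N : n.-tuple R -> R) (p : R) :
  (forall x : n.-tuple R, [set` x] `<=` I -> M x = N x) ->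
  internality_point I M p -> internality_point I N p.
Proof.
move=> MN [Ip hp]; split=> // y z zE yI Nz; apply: (hp y z) => //.
rewrite MN // => a az; have : a \in tval z := az.
by rewrite zE => /predU1P[->//|]; exact: yI.
Qed.

(** Continuity at [m] ensures that no average hides in a jump of [f]. The resulting linear equation
    is the form in which [f] and [g] are compared. *)
Lemma mean_sumE (R : realType) (I : set R) (f : R -> R) (n : nat)
    (z : n.-tuple R) (m : R) :
  is_interval I -> strictly_increasing_on I f -> (0 < n)%N -> nbhs m I ->
  {for m, continuous f} -> [set` z] `<=` I ->
  quasiarithmetic_mean I f z = m <-> \sum_(a <- z) f a = n%:R * f m.
Proof.
move=> hI hf n0 mI fc zI.
have nn0 : n%:R != 0 :> R by rewrite pnatr_eq0 -lt0n.
split=> [zm|zm].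
  have <- : (\sum_(a <- z) f a) / n%:R = f m; last by field.
  apply: (generalized_inverseK_continuous _ I) => //.
  by rewrite -{2}(size_tuple z); apply: average_conv => //; rewrite size_tuple.
have [_ _ can] := generalized_inverseP hI hf.
rewrite /quasiarithmetic_mean zm mulrC mulKf //.
by apply: can; apply: nbhs_singleton.
Qed.

(** * The Jensen equation on a segment *)

(** At a maximum point [c], an endpoint at least as near to [c] as the other in the scale of [f] is
    reflected to a point [y] of the segment with [D y = 2 * D c]. Then [D y <= D c] forces
    [D c <= 0]. *)
Lemma jensen_max_principle (R : realType) (f D : R -> R) (a b : R) :
  a <= b -> {in `[a, b] &, {homo f : x y / x < y}} ->
  {within `[a, b], continuous f} -> {within `[a, b], continuous D} ->
  D a = 0 -> D b = 0 ->
  (forall x y z, x \in `[a, b] -> y \in `[a, b] -> z \in `[a, b] ->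
     f x + f y = 2 * f z -> D x + D y = 2 * D z) ->
  forall x, x \in `[a, b] -> D x <= 0.
Proof.
move=> ab fincr fc Dc Da Db J x xab.
have [c cab cmax] := EVT_max ab Dc.
apply: le_trans (cmax x xab) _.
have aab : a \in `[a, b] by rewrite in_itv /= lexx ab.
have bab : b \in `[a, b] by rewrite in_itv /= lexx ab.
have fle : {in `[a, b] &, {homo f : x y / x <= y}}.
  exact: ltW_homo_in.
have /andP[ac cb] : a <= c <= b by rewrite in_itv in cab.
have fac := fle _ _ aab cab ac; have fcb := fle _ _ cab bab cb.
have min_ab : Num.min (f a) (f b) = f a by apply/min_idPl; lra.
have max_ab : Num.max (f a) (f b) = f b by apply/max_idPr; lra.
have [h|h] := leP (f c - f a) (f b - f c).
- have [|y yab fy] := @IVT R f a b (2 * f c - f a) ab fc.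
    by rewrite min_ab max_ab; lra.
  have := J a y c aab yab cab _; have := cmax y yab; lra.
- have [|y yab fy] := @IVT R f a b (2 * f c - f b) ab fc.
    by rewrite min_ab max_ab; lra.
  have := J b y c bab yab cab _; have := cmax y yab; lra.
Qed.

(** * Increment ratios of [f] against [g] *)

Definition slope {R : realType} (f g : R -> R) (a b : R) : R :=
  (f b - f a) / (g b - g a).

Lemma affine_on_segment (R : realType) (I V : set R) (f g : R -> R) (n : nat)
    (a b x : R) :
  V `<=` I -> strictly_increasing_on I f -> strictly_increasing_on I g ->
  (1 < n)%N -> {in V, continuous f} -> {in V, continuous g} ->
  (forall m (s : seq R), V m -> [set` s] `<=` I -> size s = n ->
     \sum_(t <- s) f t = n%:R * f m -> \sum_(t <- s) g t = n%:R * g m) ->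
  a < b -> `[a, b] `<=` V -> a <= x <= b ->
  f x - f a = slope f g a b * (g x - g a).
Proof.
move=> VI hf hg hn fc gc T ab abV xab.
have gab : g b - g a != 0.
  have := hg a b; rewrite !inE => gab; rewrite subr_eq0 gt_eqF // gab //.
    by apply/VI/abV; rewrite /= in_itv /= lexx ltW.
  by apply/VI/abV; rewrite /= in_itv /= lexx ltW.
set c := slope f g a b.
have segc (h : R -> R) : {in V, continuous h} -> {within `[a, b], continuous h}.
  move=> hc; apply: continuous_in_subspaceT => t; rewrite inE => /abV Vt.
  by apply: hc; rewrite inE.
(* The factor [k] takes the values 1 and -1, so that one upper bound yields both inequalities. *)
pose D k t := k * (f t - f a - c * (g t - g a)) : R.
have Dc k : {within `[a, b], continuous (D k)}.
  apply: segc => t Vt; apply: cvgMr; apply: cvgB.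
    by apply: cvgB; [exact: fc|exact: cvg_cst].
  by apply: cvgMr; apply: cvgB; [exact: gc|exact: cvg_cst].
suff Dle0 k : D k x <= 0.
  have := Dle0 1; have := Dle0 (-1); rewrite /D; lra.
apply: (@jensen_max_principle R f (D k) a b) => //.
- exact: ltW.
- by move=> s t sab tab; apply: hf; rewrite inE; exact/VI/abV.
- exact: segc.
- by rewrite /D; ring.
- by rewrite /D /c /slope; field.
move=> s t z sab tab zab fst.
(* Padding with [n - 2] copies of [z] turns the two-point Jensen relation into an [n]-term one, to
   which [T] applies. *)
have Js : \sum_(r <- s :: t :: nseq n.-2 z) f r = n%:R * f z.
  by rewrite sum_cons2_nseq // fst; ring.
have : \sum_(r <- s :: t :: nseq n.-2 z) g r = n%:R * g z.
  apply: T Js; first exact: abV.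
    move=> r /=; rewrite inE => /predU1P[->|]; first exact/VI/abV.
    rewrite inE => /predU1P[->|/nseqP[-> _]]; exact/VI/abV.
  by rewrite /= size_nseq -subn2 -addn2 subnK.
rewrite sum_cons2_nseq // => gz.
have gst : g s + g t = 2 * g z by lra.
have -> : D k t = k * (2 * f z - f s - f a - c * (2 * g z - g s - g a)).
  by rewrite /D -fst -gst; ring.
by rewrite /D; ring.
Qed.

(* Moving p up to p' and m up to m' so that sum f stays n f(m') also keeps
   sum g = n g(m'); hence the increment ratios of f and g at p and m agree. *)
Lemma slope_mean (R : realType) (I V : set R) (f g : R -> R) (n : nat)
    (p p1 m m1 : R) (s : seq R) :
  V `<=` I -> strictly_increasing_on I f -> strictly_increasing_on I g ->
  (1 < n)%N -> {in V, continuous f} -> {in V, continuous g} ->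
  (forall m (s : seq R), V m -> [set` s] `<=` I -> size s = n ->
     \sum_(t <- s) f t = n%:R * f m -> \sum_(t <- s) g t = n%:R * g m) ->
  p < p1 -> `[p, p1] `<=` V -> m < m1 -> `[m, m1] `<=` V ->
  [set` s] `<=` I -> (size s).+1 = n ->
  \sum_(t <- p :: s) f t = n%:R * f m ->
  slope f g p p1 = slope f g m m1.
Proof.
move=> VI hf hg hn fc gc T pp1 pV mm1 mV sI ss fm.
have aff a b x : a < b -> `[a, b] `<=` V -> a <= x <= b ->
    f x - f a = slope f g a b * (g x - g a).
  exact: (@affine_on_segment R I V f g n).
have n0 : 0 < n%:R :> R by rewrite ltr0n ltnW.
have ivt a b d : a < b -> `[a, b] `<=` V -> 0 <= d <= f b - f a ->
    exists2 x, a <= x <= b & f x = f a + d.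
  move=> ab abV d0.
  have fcab : {within `[a, b], continuous f}.
    apply: continuous_in_subspaceT => t; rewrite inE => /abV Vt.
    by apply: fc; rewrite inE.
  have min_ab : Num.min (f a) (f b) = f a by apply/min_idPl; lra.
  have max_ab : Num.max (f a) (f b) = f b by apply/max_idPr; lra.
  have [|x xab fx] := @IVT R f a b (f a + d) (ltW ab) fcab.
    by rewrite min_ab max_ab; lra.
  by exists x => //; rewrite in_itv in xab.
have end1 a b : a < b -> `[a, b] `<=` V -> V a.
  by move=> ab; apply; rewrite /= in_itv /= lexx ltW.
have end2 a b : a < b -> `[a, b] `<=` V -> V b.
  by move=> ab; apply; rewrite /= in_itv /= lexx ltW.
have finc a b : a < b -> `[a, b] `<=` V -> f a < f b.
  by move=> ab abV; apply: hf; rewrite ?inE //; apply: VI; [apply: end1 abV|apply: end2 abV].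
have fp := finc _ _ pp1 pV; have fmm := finc _ _ mm1 mV.
(* Small enough for [f] to rise by [e] within [[p, p1]] and by [e / n%:R] within [[m, m1]]: raising
   one summand by [e] raises the average by [e / n%:R]. *)
pose e := Num.min (f p1 - f p) (n%:R * (f m1 - f m)).
have e0 : 0 < e by rewrite lt_min subr_gt0 fp mulr_gt0 // subr_gt0.
have [|p' p'p fp'] := ivt p p1 e pp1 pV.
  by rewrite (ltW e0) ge_min lexx.
have [|m' m'm fm'] := ivt m m1 (e / n%:R) mm1 mV.
  by rewrite divr_ge0 ?ler_pdivrMr ?(ltW e0) ?(ltW n0) // mulrC ge_min lexx orbT.
have Vp := end1 _ _ pp1 pV; have Vm := end1 _ _ mm1 mV.
have Vp' : V p' by apply: pV.
have Vm' : V m' by apply: mV.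
have consI q : V q -> [set` q :: s] `<=` I.
  move=> Vq t; rewrite /= inE => /predU1P[->|]; [exact: VI|exact: sI].
have gm := T m (p :: s) Vm (consI _ Vp) ss fm.
have gm' : \sum_(t <- p' :: s) g t = n%:R * g m'.
  apply: (T m') (consI _ Vp') ss _ => //; move: fm.
  rewrite !big_cons fp' fm' mulrDr mulrCA divff ?gt_eqF // mulr1; lra.
move: gm gm'; rewrite !big_cons => gm gm'.
have ap := aff _ _ _ pp1 pV p'p; have am := aff _ _ _ mm1 mV m'm.
(* The entries of [s] are unchanged and cancel, leaving only the moved entry. *)
have gpm : g p' - g p = n%:R * (g m' - g m) by lra.
have fpm : f p' - f p = n%:R * (f m' - f m).
  by rewrite fp' fm'; field; rewrite gt_eqF.
have pne : g p' - g p != 0.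
  by apply: contraTneq e0 => gp0; move: ap; rewrite gp0 mulr0 fp'; lra.
apply: (mulIf pne); rewrite -ap fpm am gpm; ring.
Qed.

Lemma eq_slope (R : realType) (I V : set R) (f g : R -> R) (n : nat) (a b c d : R) :
  V `<=` I -> strictly_increasing_on I f -> strictly_increasing_on I g ->
  (1 < n)%N -> {in V, continuous f} -> {in V, continuous g} -> open V ->
  (forall m (s : seq R), V m -> [set` s] `<=` I -> size s = n ->
     \sum_(t <- s) f t = n%:R * f m -> \sum_(t <- s) g t = n%:R * g m) ->
  (forall p q, V p -> V q -> exists (s : seq R) (m : R),
     [/\ [set` s] `<=` I, (size s).+2 = n, V m &
         \sum_(t <- p :: q :: s) f t = n%:R * f m]) ->
  a < b -> `[a, b] `<=` V -> c < d -> `[c, d] `<=` V ->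
  slope f g a b = slope f g c d.
Proof.
move=> VI hf hg hn fc gc oV T att ab abV cd cdV.
have Va : V a by apply: abV; rewrite /= in_itv /= lexx ltW.
have Vc : V c by apply: cdV; rewrite /= in_itv /= lexx ltW.
have [s [m [sI ss Vm sm]]] := att a c Va Vc.
have [e e0 eV] := nbhs_segment _ _ _ (open_nbhs_nbhs (conj oV Vm)).
have meV : `[m, m + e] `<=` V.
  by move=> t; rewrite /= in_itv /= => mt; apply: eV; lra.
have mme : m < m + e by lra.
have consI q : V q -> [set` q :: s] `<=` I.
  move=> Vq t; rewrite /= inE => /predU1P[->|]; [exact: VI|exact: sI].
(* The ratio just to the right of [m] is the common value: first [a] moves while [c] stays among the
   fixed entries, then the roles are exchanged. *)
transitivity (slope f g m (m + e)).
  exact: (@slope_mean R I V f g n _ _ _ _ (c :: s) VI hf hg hn fc gc T ab abV mme meV (consI _ Vc) ss sm).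
apply/esym/(@slope_mean R I V f g n _ _ _ _ (a :: s) VI hf hg hn fc gc T cd cdV mme meV (consI _ Va) ss).
by rewrite -sm !big_cons addrCA.
Qed.

(** * Transfer from [f] to [g] and choice of the common ratio *)

Theorem proposition3p1 (R : realType) (I : set R) (f g : R -> R) (n : nat)
  (hI : is_interval I)
  (hIlen : exists a b : R, [/\ I a, I b & a < b])
  (hf : strictly_increasing_on I f)
  (hg : strictly_increasing_on I g)
  (hn : (1 < n)%N)
  (hfg : forall x : n.-tuple R, [set` x] `<=` I ->
     quasiarithmetic_mean I f x = quasiarithmetic_mean I g x)
  (hattr : attracting I 2 (@quasiarithmetic_mean R I f n)
     (interior (internality_set I (@quasiarithmetic_mean R I f n)))) :
  exists alpha : R,
    forall p : R, interior (internality_set I (@quasiarithmetic_mean R I f n)) p ->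
      exists c : R,
        forall x : R,
          connected_component
            (interior (internality_set I (@quasiarithmetic_mean R I f n))) p x ->
          f x - alpha * g x = c.
Proof.
set V : set R := interior _ in hattr *.
have oV : open V := open_interior _.
have VI : V `<=` I by move=> p /interior_subset[].
have nbI p : V p -> nbhs p I.
  by move=> Vp; apply: filterS VI _; apply: open_nbhs_nbhs.
have fc : {in V, continuous f}.
  move=> p; rewrite inE => Vp; apply: (@internality_point_continuous R I f n p) => //.
    exact: nbI.
  exact: (interior_subset Vp).
have gc : {in V, continuous g}.
  move=> p; rewrite inE => Vp; apply: (@internality_point_continuous R I g n p) => //.
    exact: nbI.
  (* Internality passes to the mean of [g] because the two means agree on tuples from [I]. *)
  exact: (eq_mean_internality_point _ _ _ _ _ _ hfg (interior_subset Vp)).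
have n0 : (0 < n)%N := ltnW hn.
have T m (s : seq R) : V m -> [set` s] `<=` I -> size s = n ->
    \sum_(t <- s) f t = n%:R * f m -> \sum_(t <- s) g t = n%:R * g m.
  move=> Vm sI /eqP ss; have mI := nbI _ Vm.
  pose z : n.-tuple R := Tuple ss.
  have fm := fc m (mem_set Vm); have gm := gc m (mem_set Vm).
  move=> /(mean_sumE R I f n z m hI hf n0 mI fm sI) zm.
  by apply/(mean_sumE R I g n z m hI hg n0 mI gm sI); rewrite -hfg.
(* The attracting property read as a sum equation; it can be so read because the mean lies in [V],
   where [f] is continuous. *)
have att p q : V p -> V q -> exists (s : seq R) (m : R),
     [/\ [set` s] `<=` I, (size s).+2 = n, V m &
         \sum_(t <- p :: q :: s) f t = n%:R * f m].
  move=> Vp Vq.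
  have [|s [z [zE sI Vz]]] := hattr.2 [tuple p; q].
    by move=> t; rewrite /= !inE => /orP[]/eqP->.
  have zs : z = p :: q :: s :> seq R by rewrite zE.
  exists s, (quasiarithmetic_mean I f z); split => //.
    by have := size_tuple z; rewrite zs.
  have fm := fc _ (mem_set Vz); rewrite -zs.
  apply/(mean_sumE R I f n z _ hI hf n0 (nbI _ Vz) fm) => //.
  move=> t tz; have : t \in tval z := tz.
  by rewrite zs => /predU1P[->|/predU1P[->|/sI//]]; exact: VI.
have [[p0 Vp0]|V0] := pselect (V !=set0); last first.
  by exists 0 => p Vp; case: V0; exists p.
have [e e0 eV] := nbhs_segment _ _ _ (open_nbhs_nbhs (conj oV Vp0)).
have p0e : p0 < p0 + e by lra.
have p0V : `[p0, p0 + e] `<=` V.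
  by move=> t; rewrite /= in_itv /= => mt; apply: eV; lra.
(* The ratio on one segment of [V], chosen arbitrarily, serves for all components, since [eq_slope]
   makes the ratio the same on every segment. *)
exists (slope f g p0 (p0 + e)) => p Vp.
have const a b : a < b -> `[a, b] `<=` V ->
    f b - slope f g p0 (p0 + e) * g b = f a - slope f g p0 (p0 + e) * g a.
  move=> ab abV.
  rewrite (@eq_slope R I V f g n _ _ a b) //.
  have := @affine_on_segment R I V f g n a b b VI hf hg hn fc gc T ab abV.
  by rewrite lexx (ltW ab) => /(_ isT); lra.
exists (f p - slope f g p0 (p0 + e) * g p) => x Cx.
have /connected_intervalP Citv := @component_connected _ V p.
have Cp := connected_component_refl Vp.
(* Components are intervals, so the segment between two points of a component stays in [V]. *)
have sub a b : connected_component V p a -> connected_component V p b ->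
    `[a, b] `<=` V.
  move=> Ca Cb t; rewrite /= in_itv /= => tab.
  by apply: (@connected_component_sub _ V p); apply: (Citv _ _ Ca Cb).
have [px|xp|->//] := ltgtP p x; first by apply: const => //; exact: sub.
by apply/esym/const => //; exact: sub.
Qed.
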